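(* Let a random iterated function system $\{\mathcal I_\omega\}_{\omega\in\Omega_0}$ with contraction factors $a_1(\omega),\dots,a_K(\omega)$ be given as in the context, and let $D=\operatorname{ess\,sup}_{\omega\in\Omega_0} d_\omega$ and $d=\operatorname{ess\,inf}_{\omega\in\Omega_0} d_\omega$, where $d_\omega\ge 0$ is defined by $\sum_{j=1}^K a_j(\omega)^{d_\omega}=1$. (i) For every $r\in[D,\infty)$ there is a choice of probability weights $p_1(\omega),\dots,p_K(\omega)$, depending on the contraction factors $a_j(\omega)$ and strictly bounded away from zero (i.e. there is $c>0$ with $p_i(\omega)\ge c$ for all $i$ and $\omega$), such that almost surely $$\overline{\dim}_\Phi\,\mu_{\boldsymbol\omega}=r\ \ge\ \overline{\dim}_\Phi\,F_{\boldsymbol\omega}$$ simultaneously for all small dimension functions $\Phi$. (ii) For every $r\in(0,d]$ there is a choice of probability weights $p_1(\omega),\dots,p_K(\omega)$, depending on the contraction factors $a_j(\omega)$ and strictly bounded away from zero, such that almost surely $$\underline{\dim}_\Phi\,\mu_{\boldsymbol\omega}=r\ \le\ \underline{\dim}_\Phi\,F_{\boldsymbol\omega}$$ simultaneously for all small dimension functions $\Phi$.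
   Context: **Dimension functions.** A dimension function is a map $\Phi:(0,1)\to[0,\infty)$ such that $t^{1+\Phi(t)}$ decreases to $0$ as $t$ decreases to $0$. It is called small if (for $t$ near $0$) $\Phi(t)=H(t)\,\frac{\log|\log t|}{|\log t|}$ with $H(t)\to0$ as $t\to0$. **$\Phi$-dimensions.** Let $X$ be a bounded metric space (here $X=[0,1]$), $B(x,R)$ the open ball with centre $x$ and radius $R$, and $N_r(E)$ the least number of open balls of radius $r$ needed to cover $E\subseteq X$. The upper $\Phi$-dimension $\overline{\dim}_\Phi E$ of a set $E\subseteq X$ is the infimum of all $d$ for which there are $C_1,C_2>0$ such that for all $0<r\le R^{1+\Phi(R)}<R<C_1$ and all $z\in E$, $N_r(B(z,R)\cap E)\le C_2(R/r)^d$. The lower $\Phi$-dimension $\underline{\dim}_\Phi E$ is the supremum of all $d$ for which there are $C_1,C_2>0$ such that for all such $r,R$ and all $z\in E$, $N_r(B(z,R)\cap E)\ge C_2(R/r)^d$. The upper $\Phi$-dimension $\overline{\dim}_\Phi\mu$ of a measure $\mu$ on $X$ is the infimum of all $d$ for which there are $C_1,C_2>0$ such that for all $0<r<R^{1+\Phi(R)}\le R\le C_1$ and all $x\in\operatorname{supp}\mu$, $\frac{\mu(B(x,R))}{\mu(B(x,r))}\le C_2(R/r)^d$ (with $\inf\emptyset=\infty$); the lower $\Phi$-dimension $\underline{\dim}_\Phi\mu$ is the supremum of all $d$ for which there are $C_1,C_2>0$ such that for all such $r,R,x$, $\frac{\mu(B(x,R))}{\mu(B(x,r))}\ge C_2(R/r)^d$.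 **Random iterated function system.** Let $(\Omega_0,P)$ be a probability space, $K\ge2$ an integer, and $A,B,\tau>0$ constants with $0<KA\le B<1$ and $\tau\le(1-B)/K$. For each $\omega\in\Omega_0$, $\mathcal I_\omega=\{S_1(\omega),\dots,S_K(\omega)\}$ is an iterated function system of $K$ similarities mapping $[0,1]$ into itself; $S_j(\omega)$ has contraction factor $a_j(\omega)$ (a random variable), with $A\le a_j(\omega)\le\sum_{i=1}^K a_i(\omega)\le B$ for all $j,\omega$, and the distance between $S_i(\omega)[0,1]$ and $S_j(\omega)[0,1]$ is at least $\tau$ for all $i\ne j$ and all $\omega$. **Probability weights.** A choice of probability weights is a choice, for each $\omega\in\Omega_0$, of $\mathcal P_\omega=\{p_1(\omega),\dots,p_K(\omega)\}$ with $p_i(\omega)\ge0$, $\sum_i p_i(\omega)=1$, the $p_i$ being random variables on $\Omega_0$ such that for some $t>0$, $\mathbb E_\omega(p_i(\omega)^{-t})<\infty$ for each $i$. In this theorem the weights are allowed to depend on $\omega$ through the contraction factors $(a_1(\omega),\dots,a_K(\omega))$. **Random set and measure.** Let $\Omega=\Omega_0^{\mathbb N}$ with the infinite product measure $\mathbb P$. For $\boldsymbol\omega=(\boldsymbol\omega_1,\boldsymbol\omega_2,\dots)\in\Omega$ put $I_{i_1,\dots,i_n}(\boldsymbol\omega)=S_{i_1}(\boldsymbol\omega_1)\circ\cdots\circ S_{i_n}(\boldsymbol\omega_n)[0,1]$. The random Moran set is $F_{\boldsymbol\omega}=\bigcap_n\bigcup_{i_1,\dots,i_n\in\{1,\dots,K\}}I_{i_1,\dots,i_n}(\boldsymbol\omega)$,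 and $\mu_{\boldsymbol\omega}$ is the Borel probability measure with $\mu_{\boldsymbol\omega}([0,1])=1$ and $\mu_{\boldsymbol\omega}(I_{i_1,\dots,i_n}(\boldsymbol\omega))=p_{i_1}(\boldsymbol\omega_1)\cdots p_{i_n}(\boldsymbol\omega_n)$ for all $n$ and $i_1,\dots,i_n$. ''Almost surely'' refers to $\mathbb P$; essential suprema/infima over $\Omega_0$ are with respect to $P$. *)

(* Defs.v *)
From HB Require Import structures.
From mathcomp Require Import all_boot all_order all_algebra.
From mathcomp Require Import all_classical all_reals all_analysis.

Set Implicit Arguments.
Unset Strict Implicit.
Unset Printing Implicit Defensive.

Import Order.TTheory GRing.Theory Num.Theory.
Import numFieldNormedType.Exports.

Local Open Scope classical_set_scope.
Local Open Scope ring_scope.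

(** Dimension functions.  They are total functions [R -> R], of which only the
    values on (0,1) are ever used. *)

Definition dimension_function (R : realType) (Phi : R -> R) : Prop :=
  [/\ forall t, 0 < t < 1 -> 0 <= Phi t,
      forall s t, 0 < s -> s <= t -> t < 1 ->
        s `^ (1 + Phi s) <= t `^ (1 + Phi t)
    & t `^ (1 + Phi t) @[t --> 0^'+] --> (0 : R)].

Definition small_dimension_function (R : realType) (Phi : R -> R) : Prop :=
  dimension_function Phi /\
  exists H : R -> R,
    (\forall t \near 0^'+, Phi t = H t * (ln `|ln t| / `|ln t|)) /\
    H t @[t --> 0^'+] --> (0 : R).

(** Phi-dimensions in the metric space [0,1].  On the real line [ball x e] is
    the open interval ]x - e, x + e[; its trace on [0,1] is the ball of the
    metric space [0,1], and all sets (resp. measures) considered are contained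
    in (resp. carried by) [0,1].  The dimensions are extended reals, so that
    the infimum of the empty set is +oo. *)

Definition covering_number (R : realType) (r : R) (E : set R) : \bar R :=
  ereal_inf [set n%:R%:E | n in [set n : nat |
    exists c : 'I_n -> R,
      (forall i, 0 <= c i <= 1) /\ E `<=` \bigcup_i ball (c i) r]].

(** [rr] is the larger radius [R] of the literature.  The condition [rr < 1]
    only says that [rr] lies in the domain of [Phi]. *)
Definition set_scales (R : realType) (Phi : R -> R) (C1 rr r : R) : Prop :=
  [/\ rr < 1, 0 < r, r <= rr `^ (1 + Phi rr), rr `^ (1 + Phi rr) < rr
    & rr < C1].

Definition upper_dim_set (R : realType) (Phi : R -> R) (E : set R) : \bar R :=
  ereal_inf [set d%:E | d in [set d : R |
    exists C1 C2 : R, [/\ 0 < C1, 0 < C2 &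
      forall rr r z, set_scales Phi C1 rr r -> E z ->
        (covering_number r (ball z rr `&` E) <= (C2 * (rr / r) `^ d)%:E)%E]]].

Definition lower_dim_set (R : realType) (Phi : R -> R) (E : set R) : \bar R :=
  ereal_sup [set d%:E | d in [set d : R |
    exists C1 C2 : R, [/\ 0 < C1, 0 < C2 &
      forall rr r z, set_scales Phi C1 rr r -> E z ->
        ((C2 * (rr / r) `^ d)%:E <= covering_number r (ball z rr `&` E))%E]]].

Definition measure_scales (R : realType) (Phi : R -> R) (C1 rr r : R) : Prop :=
  [/\ rr < 1, 0 < r, r < rr `^ (1 + Phi rr), rr `^ (1 + Phi rr) <= rr
    & rr <= C1].

Definition measure_support (R : realType)
    (mu : probability (measurableTypeR R) R) : set R :=
  [set x | forall e : R, 0 < e -> (0 < mu (ball x e))%E].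

Definition ball_ratio (R : realType)
    (mu : probability (measurableTypeR R) R) (x rr r : R) : R :=
  fine (mu (ball x rr)) / fine (mu (ball x r)).

Definition upper_dim_measure (R : realType) (Phi : R -> R)
    (mu : probability (measurableTypeR R) R) : \bar R :=
  ereal_inf [set d%:E | d in [set d : R |
    exists C1 C2 : R, [/\ 0 < C1, 0 < C2 &
      forall rr r x, measure_scales Phi C1 rr r -> measure_support mu x ->
        ball_ratio mu x rr r <= C2 * (rr / r) `^ d]]].

Definition lower_dim_measure (R : realType) (Phi : R -> R)
    (mu : probability (measurableTypeR R) R) : \bar R :=
  ereal_sup [set d%:E | d in [set d : R |
    exists C1 C2 : R, [/\ 0 < C1, 0 < C2 &
      forall rr r x, measure_scales Phi C1 rr r -> measure_support mu x ->
        C2 * (rr / r) `^ d <= ball_ratio mu x rr r]]].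

(** The product sigma-algebra on [T^nat], and the infinite product measure,
    which is determined by its values on finite-dimensional boxes. *)

Definition coordinate_sets d (T : measurableType d) : set (set (nat -> T)) :=
  [set A | exists (k : nat) (B : set T),
    measurable B /\ A = [set w : nat -> T | B (w k)]].

Notation seq_space T := (g_sigma_algebraType (@coordinate_sets _ T)).

Definition infinite_product_measure d (T : measurableType d) (R : realType)
    (P : probability T R) (PP : probability (seq_space T) R) : Prop :=
  forall (n : nat) (B : 'I_n -> set T), (forall k, measurable (B k)) ->
    PP [set w : nat -> T | forall k : 'I_n, B k (w k)] =
      (\prod_(k < n) P (B k))%E.

(** Random iterated function systems.  [S w j] is a map on the whole line of
    which only the restriction to [0,1] matters. *)

Definition set_distance (R : realType) (E F : set R) : R :=
  inf [set `|x - y| | x in E & y in F].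

Record random_ifs d (Omega0 : measurableType d) (R : realType) (K : nat)
    (A B tau : R) (S : Omega0 -> 'I_K -> R -> R)
    (a : Omega0 -> 'I_K -> R) : Prop := RandomIFS {
  rifs_K : (2 <= K)%N;
  rifs_A : 0 < A;
  rifs_B : 0 < B;
  rifs_tau : 0 < tau;
  rifs_KA : K%:R * A <= B;
  rifs_B1 : B < 1;
  rifs_tauB : tau <= (1 - B) / K%:R;
  rifs_maps : forall w j, S w j @` `[0, 1]%classic `<=` `[0, 1]%classic;
  rifs_similarity : forall w j (x y : R), 0 <= x <= 1 -> 0 <= y <= 1 ->
    `|S w j x - S w j y| = a w j * `|x - y|;
  rifs_random : forall j, measurable_fun setT (fun w => a w j);
  rifs_factor : forall w j, A <= a w j /\ a w j <= \sum_i a w i;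
  rifs_sum : forall w, \sum_i a w i <= B;
  rifs_separated : forall w i j, i != j ->
    tau <= set_distance (S w i @` `[0, 1]%classic) (S w j @` `[0, 1]%classic)
}.

(** The inverse is taken in the extended reals, where the inverse of 0 is +oo:
    the power [p `^ (- t)] would be 0 at [p = 0]. *)
Record probability_weights d (Omega0 : measurableType d) (R : realType)
    (P : probability Omega0 R) (K : nat)
    (p : Omega0 -> 'I_K -> R) : Prop := ProbabilityWeights {
  weights_ge0 : forall w i, 0 <= p w i;
  weights_sum : forall w, \sum_i p w i = 1;
  weights_random : forall i, measurable_fun setT (fun w => p w i);
  weights_moment : exists2 t : R, 0 < t &
    forall i, (\int[P]_w ((p w i `^ t)%:E)^-1 < +oo)%E
}.

Definition depends_on (Omega0 : Type) (R : realType) (K : nat)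
    (a p : Omega0 -> 'I_K -> R) : Prop :=
  exists g : ('I_K -> R) -> ('I_K -> R), forall w, p w = g (a w).

Definition bounded_away_from_zero (Omega0 : Type) (R : realType) (K : nat)
    (p : Omega0 -> 'I_K -> R) : Prop :=
  exists2 c : R, 0 < c & forall w i, c <= p w i.

(** The random Moran set and measure.  The sequence [w] is indexed from 0; the
    composition is [S (w 0) s_0 \o ... \o S (w n.-1) s_(n-1)]. *)

Definition moran_interval (Omega0 : Type) (R : realType) (K : nat)
    (S : Omega0 -> 'I_K -> R -> R) (w : nat -> Omega0) (n : nat)
    (s : n.-tuple 'I_K) : set R :=
  (\big[(fun f g : R -> R => f \o g)/idfun]_(k < n) S (w k) (tnth s k))
    @` `[0, 1]%classic.

Definition moran_set (Omega0 : Type) (R : realType) (K : nat)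
    (S : Omega0 -> 'I_K -> R -> R) (w : nat -> Omega0) : set R :=
  \bigcap_(n in [set: nat]) \bigcup_(s in [set: n.-tuple 'I_K])
    moran_interval S w s.

Definition moran_measure (Omega0 : Type) (R : realType) (K : nat)
    (S : Omega0 -> 'I_K -> R -> R) (p : Omega0 -> 'I_K -> R)
    (w : nat -> Omega0) (mu : probability (measurableTypeR R) R) : Prop :=
  mu `[0, 1]%classic = 1%E /\
  forall (n : nat) (s : n.-tuple 'I_K),
    mu (moran_interval S w s) = (\prod_(k < n) p (w k) (tnth s k))%:E.

(* Main.v *)
Require Import Defs.
From mathcomp Require Import all_boot all_order all_algebra.
From mathcomp Require Import all_classical all_reals all_analysis.
From mathcomp Require Import measurable_realfun ess_sup_inf.
From mathcomp Require Import ring lra.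

Import Order.TTheory GRing.Theory Num.Theory.
Import numFieldNormedType.Exports.

Local Open Scope classical_set_scope.
Local Open Scope ring_scope.

(** Choose one letter [i0], give it the weight [a i0 ^ r], and share the rest of
    the mass among the other letters in proportion to [a j ^ r].  If
    [\sum_j a j ^ r <= 1], every weight satisfies [p j >= a j ^ r]; if the sum is
    at least 1, every weight satisfies [p j <= a j ^ r].  As [r] lies above the
    essential supremum (below the essential infimum) of the similarity
    dimensions, almost surely the same inequality holds at every level of the
    construction; from there on the argument is deterministic.

    Multiplying along a word, the mass of a cylinder compares with the [r]-th
    power of its length.  The gaps between first-level pieces make every ball
    centred in the Moran set comparable with a cylinder of about the same size,
    so that the ratio of the masses of two concentric balls is at most (at least)
    a constant times the [r]-th power of the ratio of the radii
    ([moran_mass_growth_le], [moran_mass_growth_ge]).  This holds for all small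
    pairs of radii, hence bounds the dimension of the measure for every [Phi] at
    once.

    The bound is sharp: at the point whose address is constantly [i0] the mass of
    a ball is comparable with the [r]-th power of its radius
    ([moran_mass_power_law]).  Since the definition of the dimensions of a measure
    lets the small radius tend to 0 while the large one is fixed, one such point
    already prevents a better exponent ([upper_dim_measure_ge],
    [lower_dim_measure_le]).

    Growth of mass finally controls covering numbers.  A separated family in a
    ball carries disjoint balls of mass bounded below, which limits its size
    ([upper_dim_set_le]); conversely each ball of a covering has small mass, so
    many are needed ([lower_dim_set_ge]).  The second argument compares masses of
    balls of radius [R] and [3 R], which is possible because weights bounded below
    by [c] dominate [a j ^ t] for [t] large. *)

(** * Powers and balls of the real line *)

Section PowerEstimates.
Context {R : realType}.
Implicit Types (x y c s t : R).

Lemma powR_div x y s : 0 < x -> 0 < y -> (x / y) `^ s = x `^ s / y `^ s.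
Proof.
move=> x0 y0; rewrite powRM ?invr_ge0 ?(ltW x0) ?(ltW y0)//.
by rewrite -powR_inv1 ?(ltW y0)// powRAC powR_inv1 ?powR_ge0.
Qed.

Lemma powR_unbounded s (c T : R) : 0 < s ->
  exists t : R, [/\ 0 < t, T < t & c < t `^ s].
Proof.
move=> s0; pose m := `|c| `^ s^-1.
exists (1 + `|T| + m); have m0 : 0 <= m by exact: powR_ge0.
have T0 := normr_ge0 T; have TT := ler_norm T.
split; [lra|lra|].
have cE : `|c| = m `^ s by rewrite /m -powRrM mulVf ?gt_eqF// powRr1.
rewrite (le_lt_trans (ler_norm c))// cE.
by apply: gt0_ltr_powR; rewrite ?nnegrE//; lra.
Qed.

Lemma powR_le_base s : 0 <= s -> forall x y, 0 <= x -> x <= y -> x `^ s <= y `^ s.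
Proof.
move=> s0 x y x0 xy; apply: ge0_ler_powR; rewrite ?nnegrE//.
exact: le_trans xy.
Qed.

Lemma powR_dominated (k l T s d : R) : 0 < k ->
  (forall t, T < t -> k * t `^ s <= l * t `^ d) -> s <= d.
Proof.
move=> k0 H; rewrite leNgt; apply/negP => ds.
have [t [t0 Tt lt]] := powR_unbounded (s - d) (l / k) T ltac:(lra).
have := H _ Tt; apply/negP; rewrite -ltNge.
have -> : t `^ s = t `^ (s - d) * t `^ d.
  by rewrite -powRD ?subrK// (gt_eqF t0) implybT.
by rewrite mulrA ltr_pM2r ?powR_gt0// mulrC -ltr_pdivrMr.
Qed.

Lemma ball_subset_ball x y (r rr : R) : `|x - y| + r <= rr -> ball x r `<=` ball y rr.
Proof.
move=> h z; rewrite -ball_normE /ball_/= => xz.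
have -> : y - z = (x - z) - (x - y) by lra.
by rewrite (le_lt_trans (ler_normB _ _))// (lt_le_trans _ h)// addrC ltrD2l.
Qed.

End PowerEstimates.

(** * Growth of the mass of balls, and dimensions *)

Section MassOfBalls.
Context {R : realType} (mu : probability (measurableTypeR R) R).
Implicit Types (x y z : R) (r rr s : R) (E : set R).

Definition ball_mass x r : R := fine (mu (ball x r)).

Lemma ball_massE x r : mu (ball x r) = (ball_mass x r)%:E.
Proof. by rewrite /ball_mass fineK// fin_num_measure//; exact: measurable_ball. Qed.

Lemma ball_mass_ge0 x r : 0 <= ball_mass x r.
Proof. by rewrite -lee_fin -ball_massE. Qed.

Lemma le_ball_mass x y r rr : ball x r `<=` ball y rr ->
  ball_mass x r <= ball_mass y rr.
Proof.
by move=> h; rewrite -lee_fin -!ball_massE le_measure// inE; exact: measurable_ball.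
Qed.

Lemma ball_mass_gt0 x r : measure_support mu x -> 0 < r -> 0 < ball_mass x r.
Proof. by move=> sx r0; rewrite -lte_fin -ball_massE; exact: sx. Qed.

Lemma measure_bigsetU_le n (D : 'I_n -> set R) (M : R) :
  (forall i, measurable (D i : set (measurableTypeR R))) ->
  (forall i, (mu (D i) <= M%:E)%E) ->
  (mu (\big[setU/set0]_(i < n) D i) <= (n%:R * M)%:E)%E.
Proof.
move=> mD DM; rewrite -[n in n%:R]card_ord mulr_natl -sumr_const -sumEFin.
pose Q (A : set R) (t : \bar R) :=
  measurable (A : set (measurableTypeR R)) /\ (mu A <= t)%E.
suff [] : Q (\big[setU/set0]_(i < n) D i) (\sum_(i in 'I_n) M%:E)%E by [].
apply: (big_ind2 Q).
- by split; [exact: measurable0|rewrite measure0].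
- move=> A1 t1 A2 t2 [mA1 le1] [mA2 le2]; split; first exact: measurableU.
  exact: le_trans (measureU2 _ _ _) (leeD _ _).
- by move=> i _; split.
Qed.

(** The growth conditions range over all pairs of small radii, with no reference
    to a dimension function: they are the defining conditions of the Assouad and
    lower Assouad dimensions of a measure. *)
Definition mass_growth_le E s := exists C rho : R, [/\ 0 < C, 0 < rho &
  forall x rr r, E x -> 0 < r -> r <= rr -> rr <= rho ->
    ball_mass x rr <= C * (rr / r) `^ s * ball_mass x r].

Definition mass_growth_ge E s := exists C rho : R, [/\ 0 < C, 0 < rho &
  forall x rr r, E x -> 0 < r -> r <= rr -> rr <= rho ->
    (rr / r) `^ s * ball_mass x r <= C * ball_mass x rr].

Definition mass_power_law x s := exists c C rho : R,
  [/\ 0 < c, 0 < C, 0 < rho &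
   forall r, 0 < r -> r <= rho -> c * r `^ s <= ball_mass x r <= C * r `^ s].

Lemma mass_power_law_ratio x s : measure_support mu x -> mass_power_law x s ->
  exists k l rho : R, [/\ 0 < k, 0 < l, 0 < rho &
    forall rr r, 0 < r -> r <= rr -> rr <= rho ->
      k * (rr / r) `^ s <= ball_ratio mu x rr r <= l * (rr / r) `^ s].
Proof.
move=> sx [c [C [rho [c0 C0 rho0 H]]]].
exists (c / C), (C / c), rho; split; [exact: divr_gt0|exact: divr_gt0|by []|].
move=> rr r r0 rle rrho; have rr0 : 0 < rr by exact: lt_le_trans rle.
have /andP[lo hi] := H _ rr0 rrho.
have /andP[rlo rhi] := H _ r0 (le_trans rle rrho).
have rs0 : 0 < r `^ s by exact: powR_gt0.
have rrs0 : 0 < rr `^ s by exact: powR_gt0.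
have mr0 : 0 < ball_mass x r by exact: ball_mass_gt0.
rewrite powR_div// /ball_ratio -!/(ball_mass _ _); apply/andP; split.
  rewrite mulf_div ler_pdivrMr ?mulr_gt0// mulrAC ler_pdivlMr//.
  by rewrite ler_pM// ?mulr_ge0 ?ltW.
rewrite mulf_div ler_pdivrMr// mulrAC ler_pdivlMr ?mulr_gt0//.
by rewrite ler_pM// ?mulr_ge0 ?ltW ?(lt_le_trans _ lo)// mulr_gt0.
Qed.

(** Packing: balls of radius [r / 2] around the points of the family are disjoint
    and lie in [ball z (2 * rr)]; that ball lies in [ball (c i) (3 * rr)], so each
    small ball carries a proportion at least of order [(r / rr) ^ s] of its mass. *)
Lemma separated_card_le E s : (forall x, E x -> measure_support mu x) ->
    mass_growth_le E s ->
  exists C rho : R, [/\ 0 < C, 0 < rho & forall n rr r z (c : 'I_n -> R),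
    0 < r -> r <= rr -> rr <= rho ->
    (forall i, (ball z rr `&` E) (c i)) ->
    (forall i j, i != j -> r <= `|c i - c j|) ->
    n%:R <= C * (rr / r) `^ s].
Proof.
move=> Esupp [C [rho [C0 rho0 H]]].
exists (C * 6 `^ s), (rho / 3); split; [by rewrite mulr_gt0// powR_gt0|lra|].
move=> n rr r z c r0 rle rrho cE csep.
have rr0 : 0 < rr by exact: lt_le_trans rle.
have [n0|n_gt0] := posnP n; first by subst n; rewrite !mulr_ge0 ?powR_ge0// ltW.
have cz i : `|z - c i| < rr by case: (cE i); rewrite -ball_normE.
set M := ball_mass z (2 * rr).
have M0 : 0 < M.
  case: (cE (Ordinal n_gt0)) => _ /Esupp sc.
  apply: (lt_le_trans (ball_mass_gt0 _ _ sc rr0)); apply: le_ball_mass.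
  by apply: ball_subset_ball; rewrite distrC; have := cz (Ordinal n_gt0); lra.
have Mle i : M <= C * (6 * (rr / r)) `^ s * ball_mass (c i) (r / 2).
  apply: le_trans (_ : ball_mass (c i) (3 * rr) <= _).
    by apply/le_ball_mass/ball_subset_ball; have := cz i; lra.
  have := H (c i) (3 * rr) (r / 2) (cE i).2 ltac:(lra) ltac:(lra) ltac:(lra).
  by rewrite (_ : 3 * rr / (r / 2) = 6 * (rr / r))//; field; rewrite gt_eqF.
have disj : trivIset [set: 'I_n] (fun i => ball (c i) (r / 2)).
  apply/trivIsetP => i j _ _ /csep sep; rewrite -subset0 => y [].
  rewrite -ball_normE /ball_/= => yi yj.
  have := ler_distD y (c i) (c j); rewrite [`|y - _|]distrC; lra.
have sumle : \sum_(i < n) ball_mass (c i) (r / 2) <= M.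
  rewrite -lee_fin -sumEFin; under eq_bigr do rewrite -ball_massE.
  rewrite -measure_bigsetU_ord//; last by move=> i; exact: measurable_ball.
  rewrite -ball_massE; apply: le_measure; rewrite ?inE.
  - by apply: bigsetU_measurable => i _; exact: measurable_ball.
  - exact: measurable_ball.
  apply: (big_ind (fun A => A `<=` ball z (2 * rr))) => //.
    by move=> A1 A2 s1 s2; rewrite subUset.
  by move=> i _; apply: ball_subset_ball; have := cz i; rewrite distrC; lra.
have := ler_sum (index_enum 'I_n) (fun i (_ : true) => Mle i).
rewrite sumr_const card_ord -mulr_sumr => le1.
rewrite -(ler_pM2r M0) mulr_natl; apply: (le_trans le1).
rewrite powRM ?divr_ge0 ?(ltW rr0) ?(ltW r0)// mulrA.
by rewrite ler_wpM2l// !mulr_ge0 ?powR_ge0 ?ltW.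
Qed.

Section MeasureDimensions.
Variable Phi : R -> R.

Lemma upper_dim_measure_le s : mass_growth_le (measure_support mu) s ->
  (upper_dim_measure Phi mu <= s%:E)%E.
Proof.
move=> [C [rho [C0 rho0 H]]]; apply: ereal_inf_lbound; exists s => //.
exists rho, C; split=> // rr r x [_ r0 rlt rle rrC] sx.
rewrite /ball_ratio ler_pdivrMr; last exact: ball_mass_gt0.
by apply: H => //; rewrite ltW// (lt_le_trans rlt).
Qed.

Lemma lower_dim_measure_ge s : mass_growth_ge (measure_support mu) s ->
  (s%:E <= lower_dim_measure Phi mu)%E.
Proof.
move=> [C [rho [C0 rho0 H]]]; apply: ereal_sup_ubound; exists s => //.
exists rho, C^-1; split=> //; first by rewrite invr_gt0.
move=> rr r x [_ r0 rlt rle rrC] sx.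
rewrite /ball_ratio ler_pdivlMr; last exact: ball_mass_gt0.
rewrite -mulrA ler_pdivrMl//.
by apply: H => //; rewrite ltW// (lt_le_trans rlt).
Qed.

Hypothesis Phi0 : forall t, 0 < t < 1 -> 0 <= Phi t.

(** The small radius is unconstrained from below: for a suitable fixed radius [rr]
    all the pairs [(rr, rr / t)] with [t] large are admissible. *)
Lemma measure_scales_unbounded C1 rho (T : R) : 0 < C1 -> 0 < rho ->
  exists2 rr, rr <= rho & exists2 t0, T <= t0 & forall t, t0 < t ->
    [/\ 0 < rr / t, rr / t <= rr, rr / (rr / t) = t
      & measure_scales Phi C1 rr (rr / t)].
Proof.
move=> C0 rho0; pose rr := Num.min (2^-1) (Num.min C1 rho).
have rr0 : 0 < rr by rewrite !lt_min C0 rho0 invr_gt0 ltr0n.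
have rr2 : rr <= 2^-1 by rewrite ge_min lexx.
have rr1 : rr < 1 by lra.
have rrC : rr <= C1 by rewrite !ge_min lexx !orbT.
exists rr; first by rewrite !ge_min lexx !orbT.
have th0 : 0 < rr `^ (1 + Phi rr) by exact: powR_gt0.
have thr : rr `^ (1 + Phi rr) <= rr.
  rewrite -[leRHS]powRr1 ?(ltW rr0)//.
  by apply: ger_powR; rewrite ?rr0 ?(ltW rr1)// lerDl Phi0// rr0.
exists (Num.max T (rr / rr `^ (1 + Phi rr))); first by rewrite le_max lexx.
move=> t; rewrite gt_max => /andP[_ tt].
have t1 : 1 < t by rewrite (le_lt_trans _ tt)// ler_pdivlMr// mul1r.
have t0 : 0 < t by lra.
split=> //.
- exact: divr_gt0.
- by rewrite ler_pdivrMr// ler_peMr ?ltW.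
- by rewrite invf_div mulrCA divff ?mulr1// gt_eqF.
- by split=> //; [exact: divr_gt0|rewrite ltr_pdivrMr// mulrC -ltr_pdivrMr].
Qed.

(** An exponent [d] in the definition gives [k * t ^ s <= C2 * t ^ d] for all
    large [t], at the single point [x]. *)
Lemma upper_dim_measure_ge x s : measure_support mu x -> mass_power_law x s ->
  (s%:E <= upper_dim_measure Phi mu)%E.
Proof.
move=> sx /(mass_power_law_ratio _ _ sx)[k [l [rho [k0 l0 rho0 H]]]].
apply: le_ereal_inf_tmp => _ [d [C1 [C2 [C10 C20 bnd]]] <-].
have [rr rrho [t0 _ scales]] := measure_scales_unbounded C1 rho 0 C10 rho0.
rewrite lee_fin; apply: (powR_dominated k C2 t0 s d k0) => t t0t.
have [r0 rle rrt sc] := scales t t0t.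
have /andP[lo _] := H _ _ r0 rle rrho.
by move: (bnd _ _ _ sc sx) lo; rewrite rrt => /[swap]; exact: le_trans.
Qed.

Lemma lower_dim_measure_le x s : measure_support mu x -> mass_power_law x s ->
  (lower_dim_measure Phi mu <= s%:E)%E.
Proof.
move=> sx /(mass_power_law_ratio _ _ sx)[k [l [rho [k0 l0 rho0 H]]]].
apply: ge_ereal_sup => _ [d [C1 [C2 [C10 C20 bnd]]] <-].
have [rr rrho [t0 _ scales]] := measure_scales_unbounded C1 rho 0 C10 rho0.
rewrite lee_fin; apply: (powR_dominated C2 l t0 d s C20) => t t0t.
have [r0 rle rrt sc] := scales t t0t.
have /andP[_ hi] := H _ _ r0 rle rrho.
by move: (bnd _ _ _ sc sx) hi; rewrite rrt; exact: le_trans.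
Qed.

End MeasureDimensions.

(** A maximal [r]-separated family of centres is also a covering by balls of
    radius [r]; the packing bound shows that a maximal family exists. *)
Lemma upper_dim_set_le (Phi : R -> R) E s :
    E `<=` `[0, 1] -> (forall x, E x -> measure_support mu x) ->
    mass_growth_le E s ->
  (upper_dim_set Phi E <= s%:E)%E.
Proof.
move=> E01 Esupp /(separated_card_le _ _ Esupp)[C [rho [C0 rho0 card_le]]].
apply: ereal_inf_lbound; exists s => //; exists rho, C; split=> //.
move=> rr r z [_ r0 rth thr rrrho] Ez.
have rle : r <= rr by exact: le_trans rth (ltW thr).
pose packed n := exists c : 'I_n -> R, (forall i, (ball z rr `&` E) (c i)) /\
  (forall i j, i != j -> r <= `|c i - c j|).
have bound n : packed n -> n%:R <= C * (rr / r) `^ s.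
  by move=> [c [cE csep]]; apply: (card_le n rr r z c) => //; exact: ltW.
have packed_le n : `[< packed n >] -> (n <= Num.truncn (C * (rr / r) `^ s))%N.
  by move=> /asboolP/bound; rewrite truncn_ge_nat// mulr_ge0 ?powR_ge0// ltW.
have packed0 : exists n, `[< packed n >].
  by exists 0%N; apply/asboolP; exists (fun=> z); split => [[]|[]].
case: (ex_maxnP packed0 packed_le) => n /asboolP pn nmax.
apply: (@le_trans _ _ n%:R%:E); last by rewrite lee_fin; exact: bound.
case: pn => c [cE csep]; apply: ereal_inf_lbound; exists n => //; exists c.
split=> [i|y [zy Ey]].
  by have [_ /E01] := cE i; rewrite /= in_itv.
apply: contrapT => ycov; suff : (n.+1 <= n)%N by rewrite ltnn.
have far i : r <= `|c i - y|.
  rewrite leNgt; apply/negP => ciy; apply: ycov; exists i => //.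
apply: nmax; apply/asboolP.
exists (fun i => oapp c y (unlift ord0 i)); split=> [i|i j].
  by case: unliftP => [k|] _ /=; [exact: cE|].
case: unliftP => [k|] ->; case: unliftP => [l|] -> //=.
  by move=> kl; apply: csep; apply: contraNneq kl => ->.
by rewrite distrC.
Qed.

(** The mass of [ball z rr] is shared among the covering balls.  Each of those that
    meets [E] inside [ball z rr] lies in a ball of twice the radius centred in [E],
    whose mass is at most of order [(r / rr) ^ s] times that of [ball z rr]; the
    second growth condition, with any exponent [t], is a doubling property. *)
Lemma lower_dim_set_ge (Phi : R -> R) E s t :
    mu.-negligible (~` E) -> (forall x, E x -> measure_support mu x) ->
    mass_growth_ge E s -> mass_growth_le E t ->
  (s%:E <= lower_dim_set Phi E)%E.
Proof.
move=> [N [mN N0 EN]] Esupp [C [rho [C0 rho0 H]]] [C' [rho' [C'0 rho'0 H']]].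
pose k := C * (C' * 3 `^ t).
have k0 : 0 < k by rewrite !mulr_gt0// powR_gt0.
apply: ereal_sup_ubound; exists s => //.
exists (Num.min (rho / 2) (rho' / 3)), k^-1.
split; [by rewrite lt_min !divr_gt0|by rewrite invr_gt0|].
move=> rr r z [_ r0 rth thr]; rewrite lt_min => /andP[rrrho rrrho'] Ez.
have rle : r <= rr by exact: le_trans rth (ltW thr).
have rr0 : 0 < rr by exact: lt_le_trans rle.
apply: le_ereal_inf_tmp => _ [n [c [_ cov]] <-].
rewrite lee_fin mulrC ler_pdivrMr//.
have q0 : 0 < (rr / r) `^ s by rewrite powR_gt0// divr_gt0.
set m := ball_mass z rr; have m0 : 0 < m by exact: ball_mass_gt0 (Esupp _ Ez) _.
(* The bound on the mass of one covering ball: passing from [ball x (2 * rr)] to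
   [ball z rr] through [ball z (3 * rr)] costs the factor [3 ^ t] in [k]. *)
pose b := k * m / (rr / r) `^ s.
have b0 : 0 <= b by rewrite !mulr_ge0 ?invr_ge0 ?ltW.
have ballb x : ball z rr x -> E x -> ball_mass x (2 * r) <= b.
  rewrite -ball_normE /ball_/= => zx Ex.
  rewrite ler_pdivlMr// mulrC.
  have := H x (2 * rr) (2 * r) Ex ltac:(lra) ltac:(lra) ltac:(lra).
  rewrite -mulf_div divff// mul1r => le1; apply: (le_trans le1).
  rewrite /k -!mulrA ler_pM2l// mulrA.
  have := H' z (3 * rr) rr Ez rr0 ltac:(lra) ltac:(lra).
  rewrite mulfK ?gt_eqF//; apply: le_trans.
  by apply/le_ball_mass/ball_subset_ball; rewrite distrC; lra.
(* Covering balls that do not meet [E] near [z] may be heavy: they are discarded. *)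
pose D i := if `[< exists x, [/\ ball (c i) r x, ball z rr x & E x] >]
            then ball (c i) r else set0.
have mD i : measurable (D i : set (measurableTypeR R)).
  by rewrite /D; case: ifP => _; [exact: measurable_ball|exact: measurable0].
have Db i : (mu (D i) <= b%:E)%E.
  rewrite /D; case: ifPn => [/asboolP[x [cx zx Ex]]|_]; last by rewrite measure0.
  rewrite ball_massE lee_fin (le_trans _ (ballb _ zx Ex))//.
  apply/le_ball_mass/ball_subset_ball.
  by move: cx; rewrite -ball_normE /ball_/=; lra.
have sub : ball z rr `<=` N `|` \big[setU/set0]_(i < n) D i.
  move=> y zy; have [Ey|/EN] := pselect (E y); last by left.
  right; have [i _ ciy] := cov y (conj zy Ey).
  rewrite (bigD1 i)//=; left; rewrite /D ifT//.
  by apply/asboolP; exists y.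
have mU : measurable (\big[setU/set0]_(i < n) D i : set (measurableTypeR R)).
  by apply: bigsetU_measurable.
have : (m%:E <= (n%:R * b)%:E)%E.
  rewrite -ball_massE (le_trans _ (measure_bigsetU_le n D b mD Db))//.
  rewrite -[leRHS]add0e -N0; apply: le_trans (measureU2 _ _ _) => //.
  by apply: le_measure; rewrite ?inE//; [exact: measurable_ball|exact: measurableU].
rewrite lee_fin /b mulrA ler_pdivlMr// => le1.
by rewrite -(ler_pM2r m0) -mulrA mulrC.
Qed.

End MassOfBalls.

(** * Cylinders of a random iterated function system *)

(** A Moran interval peels off its outermost map by definition; refining it by one
    level requires peeling off the innermost one. *)
Lemma big_comp_recr (T : Type) n (F : nat -> T -> T) :
  \big[(fun f g => f \o g)/idfun]_(k < n.+1) F k =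
  (\big[(fun f g => f \o g)/idfun]_(k < n) F k) \o F n.
Proof.
elim: n F => [|n IH] F; first by rewrite big_ord_recl !big_ord0.
rewrite big_ord_recl /= (IH (fun k => F k.+1)).
by rewrite [X in _ = X \o _]big_ord_recl.
Qed.

Section Cylinders.
Context {R : realType} {disp : measure_display} {Omega0 : measurableType disp}.
Context {K : nat} {A B tau : R}.
Context {S : Omega0 -> 'I_K -> R -> R} {a : Omega0 -> 'I_K -> R}.
Hypothesis hS : random_ifs A B tau S a.

Let A0 : 0 < A. Proof. exact: rifs_A hS. Qed.
Let tau0 : 0 < tau. Proof. exact: rifs_tau hS. Qed.

Lemma factor_ge w j : A <= a w j.
Proof. exact: (rifs_factor hS w j).1. Qed.

Lemma factor_gt0 w j : 0 < a w j.
Proof. exact: lt_le_trans A0 (factor_ge w j). Qed.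

Lemma factor_le w j : a w j <= B.
Proof. exact: le_trans (rifs_factor hS w j).2 (rifs_sum hS w). Qed.

Lemma factor_lt1 w j : a w j < 1.
Proof. exact: le_lt_trans (factor_le w j) (rifs_B1 hS). Qed.

Lemma similarity_unit w j x : 0 <= x <= 1 -> 0 <= S w j x <= 1.
Proof.
move=> x01; have := rifs_maps hS (w := w) (j := j) (t := S w j x).
by rewrite /= in_itv/=; apply; exists x => //; rewrite /= in_itv.
Qed.

Lemma first_level_separated w i j x y : i != j -> 0 <= x <= 1 -> 0 <= y <= 1 ->
  tau <= `|S w i x - S w j y|.
Proof.
move=> ij x01 y01; apply: (le_trans (rifs_separated hS w ij)).
apply: ge_inf; first by exists 0 => _ [? _ [? _ <-]].
by exists (S w i x); [exists x => //; rewrite /= in_itv|];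
  exists (S w j y) => //; exists y => //; rewrite /= in_itv.
Qed.

Lemma tau_le1 : tau <= 1.
Proof.
apply: (le_trans (rifs_tauB hS)); have K2 := rifs_K hS.
have B0 := rifs_B hS.
have K1 : 1 <= K%:R :> R by rewrite ler1n ltnW.
by rewrite ler_pdivrMr; lra.
Qed.

Variable w : nat -> Omega0.
Implicit Types (u v : nat -> 'I_K) (n k : nat) (x y : R).

(** Finite words are replaced by infinite addresses [u] together with a length [n],
    so that the cylinders around a point form a sequence. *)
Definition branch u n : R -> R :=
  \big[(fun f g : R -> R => f \o g)/idfun]_(k < n) S (w k) (u k).

Definition cylinder u n : set R := branch u n @` `[0, 1].

Definition cylinder_length u n : R := \prod_(k < n) a (w k) (u k).

Lemma branchS u n : branch u n.+1 = branch u n \o S (w n) (u n).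
Proof. exact: (@big_comp_recr R n (fun k => S (w k) (u k))). Qed.

Lemma eq_branch u v n : (forall k, (k < n)%N -> u k = v k) -> branch u n = branch v n.
Proof. by move=> uv; apply: eq_bigr => k _; rewrite uv. Qed.

Lemma branch_unit u n x : 0 <= x <= 1 -> 0 <= branch u n x <= 1.
Proof.
elim: n x => [|n IH] x x01; first by rewrite /branch big_ord0.
by rewrite branchS /=; apply/IH/similarity_unit.
Qed.

Lemma cylinder_length0 u : cylinder_length u 0 = 1.
Proof. by rewrite /cylinder_length big_ord0. Qed.

Lemma cylinder_lengthS u n :
  cylinder_length u n.+1 = cylinder_length u n * a (w n) (u n).
Proof. by rewrite /cylinder_length big_ord_recr. Qed.

Lemma cylinder_length_gt0 u n : 0 < cylinder_length u n.
Proof. by apply: prodr_gt0 => k _; exact: factor_gt0. Qed.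

Lemma cylinder_length_anti u n m : (n <= m)%N ->
  cylinder_length u m <= cylinder_length u n.
Proof.
move=> /subnK <-; elim: (m - n)%N => // k IH; apply: le_trans IH.
by rewrite addSn cylinder_lengthS ler_piMr// ltW ?factor_lt1 ?cylinder_length_gt0.
Qed.

Lemma branch_dist u n x y : 0 <= x <= 1 -> 0 <= y <= 1 ->
  `|branch u n x - branch u n y| = cylinder_length u n * `|x - y|.
Proof.
elim: n x y => [|n IH] x y x01 y01.
  by rewrite /branch big_ord0 cylinder_length0 mul1r.
rewrite branchS/= IH ?similarity_unit// (rifs_similarity hS)//.
by rewrite cylinder_lengthS mulrA.
Qed.

Lemma cylinder_diam u n x y : cylinder u n x -> cylinder u n y ->
  `|x - y| <= cylinder_length u n.
Proof.
move=> [x' + <-] [y' + <-]; rewrite /= !in_itv/= => /andP[x0 x1] /andP[y0 y1].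
rewrite branch_dist ?x0 ?y0// ler_piMr ?(ltW (cylinder_length_gt0 _ _))//.
by rewrite ler_norml; lra.
Qed.

Lemma cylinder_subset u n m : (n <= m)%N -> cylinder u m `<=` cylinder u n.
Proof.
move=> /subnK <-; elim: (m - n)%N => // k IH; apply: subset_trans IH.
move=> _ [x x01 <-]; rewrite addSn branchS /=.
by exists (S (w (k + n)) (u (k + n)%N) x) => //; move: x01;
  rewrite /= !in_itv/=; exact: similarity_unit.
Qed.

Lemma cylinder_unit u n : cylinder u n `<=` `[0, 1].
Proof.
by move=> _ [x + <-]; rewrite /= !in_itv/=; exact: branch_unit.
Qed.

Lemma cylinder_compact u n : compact (cylinder u n).
Proof.
apply: continuous_compact; last exact: segment_compact.
apply/subspace_continuousP => x x01.
apply/cvgrPdist_lt => e e0; near=> y.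
have y01 : y \in `[0, 1] by near: y; exact: withinT.
move: x01 y01; rewrite /= !in_itv /= => x01 y01.
rewrite branch_dist// (le_lt_trans _ (_ : `|x - y| < e))//.
  rewrite ler_piMl// -(cylinder_length0 u).
  exact: cylinder_length_anti.
near: y; apply: cvg_within; apply/nbhs_ballP; exists e.
Unshelve. all: by end_near. Qed.

Lemma cylinder_measurable u n :
  measurable (cylinder u n : set (measurableTypeR R)).
Proof. apply: compact_measurable; exact: cylinder_compact. Qed.

(** If the words first differ at position [k], the two points lie in distinct pieces
    of a similar copy, of ratio [cylinder_length u k], of a first-level picture, hence
    are at distance at least [tau * cylinder_length u k]. *)
Lemma eq_prefix u v n x y : cylinder u n x -> cylinder v n y ->
  `|x - y| < tau * cylinder_length u n -> forall k, (k < n)%N -> u k = v k.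
Proof.
move=> ux vy xy; elim/ltn_ind => k IH kn.
apply/eqP; apply: contraT => uv.
have uvk := eq_branch _ _ _ (fun i ik => IH i ik (ltn_trans ik kn)).
have [x' x'01 xE] := cylinder_subset _ _ _ kn _ ux.
have [y' y'01 yE] := cylinder_subset _ _ _ kn _ vy.
move: x'01 y'01 xE yE xy; rewrite /= !in_itv/= => x'01 y'01 <- <-.
rewrite !branchS/= uvk branch_dist ?similarity_unit//.
rewrite ltNge => /negP; case.
have -> : cylinder_length v k = cylinder_length u k.
  by apply: eq_bigr => i _; rewrite IH// (ltn_trans _ kn).
rewrite mulrC; apply: ler_pM.
- exact/ltW/cylinder_length_gt0.
- exact: ltW.
- exact/cylinder_length_anti/ltnW.
exact: first_level_separated.
Qed.

(** Lengths start at 1, tend to 0 and shrink by a factor at least [A] at each step,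
    so they meet every scale up to a constant. *)
Lemma exists_cylinder_length u (r : R) : 0 < r -> r <= 1 -> exists n,
  [/\ r <= cylinder_length u n, cylinder_length u n.+1 < r
    & A * cylinder_length u n <= cylinder_length u n.+1].
Proof.
move=> r0 r1.
have small : exists n, cylinder_length u n < r.
  have B0 := ltW (rifs_B hS); have B1 := rifs_B1 hS.
  have : (fun n => B ^+ n) n @[n --> \oo] --> (0 : R).
    by apply: cvg_expr; rewrite ger0_norm.
  move=> /cvgr0_norm_lt /(_ _ r0) [n _ /(_ n (leqnn n))] Bn; exists n.
  rewrite (le_lt_trans _ Bn)// ger0_norm ?exprn_ge0//.
  rewrite -[n in B ^+ n]card_ord -prodr_const; apply: ler_prod => k _.
  by rewrite factor_le ltW// factor_gt0.
case: (ex_minnP small) => -[|n]; first by rewrite cylinder_length0; lra.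
move=> lt_r nmin; exists n; split=> //.
  by rewrite leNgt; apply/negP => /nmin; rewrite ltnn.
by rewrite cylinder_lengthS mulrC ler_wpM2l ?factor_ge// ltW// cylinder_length_gt0.
Qed.

Lemma moran_interval_cylinder n (s : n.-tuple 'I_K) (j0 : 'I_K) :
  moran_interval S w s = cylinder (nth j0 s) n.
Proof.
by congr (_ @` _); apply: eq_bigr => k _; rewrite (tnth_nth j0).
Qed.

Lemma cylinder_moran_interval u n :
  cylinder u n = moran_interval S w [tuple u i | i < n].
Proof. by congr (_ @` _); apply: eq_bigr => k _; rewrite tnth_mktuple. Qed.

(** Words of different lengths that locate the same point are prefixes of one
    another, because cylinders at one level are disjoint; their last letters form
    the address. *)
Lemma moran_address x : moran_set S w x -> exists u, forall n, cylinder u n x.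
Proof.
move=> Fx; have K0 : (0 < K)%N by have := rifs_K hS; case: K.
pose j0 : 'I_K := Ordinal K0.
have /choice[s sx] : forall n, exists v, cylinder v n x.
  move=> n; have [t _ tx] := Fx n I.
  by exists (nth j0 t); rewrite -moran_interval_cylinder.
exists (fun n => s n.+1 n) => n; suff e k : (k < n)%N -> s k.+1 k = s n k.
  by have := sx n; rewrite /cylinder -(eq_branch _ _ _ e).
move=> kn; apply: (eq_prefix (s k.+1) (s n) k.+1 x x) => //.
  exact: cylinder_subset kn _ (sx n).
by rewrite subrr normr0 mulr_gt0// cylinder_length_gt0.
Qed.

Lemma address_moran u x : (forall n, cylinder u n x) -> moran_set S w x.
Proof.
move=> ux n _; exists [tuple u i | i < n] => //.
by rewrite -cylinder_moran_interval.
Qed.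

(** Cluster point of the images of 0 in the compact interval [0,1]: it belongs
    to every cylinder as these are closed and decreasing. *)
Lemma cylinders_meet u : exists x, forall n, cylinder u n x.
Proof.
pose x0 n := branch u n 0.
have x0n n m : (n <= m)%N -> cylinder u n (x0 m).
  move=> nm; apply: cylinder_subset nm _ _; exists 0 => //.
  by rewrite /= in_itv/= lexx ler01.
have [|x [_ clx]] := @segment_compact R 0 1 (x0 @ \oo) _.
  by exists 0%N => // n _; apply: (cylinder_unit u 0); exact: x0n.
exists x => n.
have cl : closed (cylinder u n) by exact: compact_closed (cylinder_compact u n).
apply: cl => U xU; apply: clx => //.
by exists n => // m /= nm; exact: x0n.
Qed.

End Cylinders.

(** * Moran measures *)

Section MoranMeasures.
Context {R : realType} {disp : measure_display} {Omega0 : measurableType disp}.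
Context {K : nat} {A B tau : R}.
Context {S : Omega0 -> 'I_K -> R -> R} {a p : Omega0 -> 'I_K -> R}.
Hypothesis hS : random_ifs A B tau S a.
Hypothesis p_gt0 : forall w j, 0 < p w j.
Hypothesis p_sum : forall w, \sum_j p w j = 1.
Variables (w : nat -> Omega0) (mu : probability (measurableTypeR R) R).
Hypothesis hmu : moran_measure S p w mu.
Implicit Types (u v : nat -> 'I_K) (n k : nat) (x y : R).

Local Notation cyl := (@cylinder R disp Omega0 K S w).
Local Notation len := (@cylinder_length R disp Omega0 K a w).

Let A0 : 0 < A. Proof. exact: rifs_A hS. Qed.
Let tau0 : 0 < tau. Proof. exact: rifs_tau hS. Qed.

Definition cylinder_mass u n : R := \prod_(k < n) p (w k) (u k).

Lemma cylinder_massS u n : cylinder_mass u n.+1 = cylinder_mass u n * p (w n) (u n).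
Proof. by rewrite /cylinder_mass big_ord_recr. Qed.

Lemma cylinder_mass_gt0 u n : 0 < cylinder_mass u n.
Proof. by apply: prodr_gt0 => k _. Qed.

Lemma measure_cylinder u n : mu (cyl u n) = (cylinder_mass u n)%:E.
Proof.
rewrite cylinder_moran_interval hmu.2; congr (_%:E).
by apply: eq_bigr => k _; rewrite tnth_mktuple.
Qed.

Definition moran_level n : set R :=
  \bigcup_(s in [set: n.-tuple 'I_K]) moran_interval S w s.

Lemma sum_level_masses n :
  \sum_(s : n.-tuple 'I_K) \prod_(k < n) p (w k) (tnth s k) = 1.
Proof.
have : \prod_(k < n) \sum_j p (w k) j = 1.
  by rewrite big1// => k _; exact: p_sum.
rewrite bigA_distr_bigA/= (reindex (fun s : n.-tuple 'I_K => [ffun k => tnth s k])).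
  by move=> e; rewrite -[RHS]e; apply: eq_bigr => s _; apply: eq_bigr => k _;
    rewrite ffunE.
exists (fun f : {ffun 'I_n -> 'I_K} => [tuple f k | k < n]) => s _.
  by apply: eq_from_tnth => k; rewrite tnth_mktuple ffunE.
by apply/ffunP => k; rewrite ffunE tnth_mktuple.
Qed.

Let j0 : 'I_K := Ordinal (ltnW (rifs_K hS)).

Lemma moran_interval_measurable n (s : n.-tuple 'I_K) :
  measurable (moran_interval S w s : set (measurableTypeR R)).
Proof.
by rewrite (moran_interval_cylinder _ _ _ j0); exact: (cylinder_measurable hS).
Qed.

Lemma moran_level_measurable n :
  measurable (moran_level n : set (measurableTypeR R)).
Proof.
apply: fin_bigcup_measurable => [|s _]; first exact: finite_finset.
exact: moran_interval_measurable.
Qed.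

Lemma moran_level_closed n : closed (moran_level n).
Proof.
apply: closed_bigcup => [|s _]; first exact: finite_finset.
rewrite (moran_interval_cylinder _ _ _ j0); apply: compact_closed => //.
exact: (cylinder_compact hS).
Qed.

Lemma moran_intervals_disjoint n :
  trivIset [set: n.-tuple 'I_K] (fun s => moran_interval S w s).
Proof.
apply/trivIsetP => s t _ _ /eqP st; rewrite -subset0 => x.
rewrite !(moran_interval_cylinder _ _ _ j0) => -[xs xt]; apply: st.
apply: eq_from_tnth => k; rewrite !(tnth_nth j0).
apply: (eq_prefix hS w _ _ n x x xs xt) => //.
by rewrite subrr normr0 mulr_gt0// (cylinder_length_gt0 hS).
Qed.

Lemma measure_moran_level n : mu (moran_level n) = 1%E.
Proof.
rewrite measure_fin_bigcup//; first last.
- by move=> s _; exact: moran_interval_measurable.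
- exact: moran_intervals_disjoint.
- exact: finite_finset.
have -> : [set: n.-tuple 'I_K] = [set` index_enum (n.-tuple 'I_K)].
  by rewrite predeqE => s; split=> // _; rewrite /= mem_index_enum.
rewrite -fsbig_seq ?index_enum_uniq//.
rewrite (eq_bigr _ (fun s _ => hmu.2 n s)).
by rewrite sumEFin sum_level_masses.
Qed.

Lemma moran_level_compl_null n : mu (~` moran_level n) = 0%E.
Proof.
rewrite probability_setC ?measure_moran_level ?subee//.
exact: moran_level_measurable.
Qed.

Lemma moran_set_compl_negligible : mu.-negligible (~` moran_set S w).
Proof.
rewrite /moran_set setC_bigcap; apply: negligible_bigcup => n.
apply/negligibleP; first by apply: measurableC; exact: moran_level_measurable.
exact: moran_level_compl_null.
Qed.

(** The cylinders of a given level carry all the mass, so only what a set catches of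
    them matters. *)
Lemma measure_le_level (X Y : set R) n :
  measurable (X : set (measurableTypeR R)) ->
  measurable (Y : set (measurableTypeR R)) ->
  X `&` moran_level n `<=` Y -> (mu X <= mu Y)%E.
Proof.
move=> mX mY XY; have mL := measurableC (moran_level_measurable n).
rewrite -[leRHS]adde0 -(moran_level_compl_null n).
apply: le_trans (measureU2 _ mY mL).
apply: le_measure; rewrite ?inE//; first exact: measurableU.
move=> x Xx; have [Lx|Lx] := pselect (moran_level n x); last by right.
by left; exact: XY.
Qed.

(** The finite union of the cylinders of one level is closed and carries all the
    mass, so a point outside it has a null neighbourhood. *)
Lemma support_moran x : measure_support mu x -> moran_set S w x.
Proof.
move=> sx n _; apply: contrapT => Lx.
have : nbhs x (~` moran_level n).
  by apply: open_nbhs_nbhs; split=> //; apply: closed_openC; exact: moran_level_closed.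
move=> /nbhs_ballP[e /= e0 eL]; have := sx e e0.
rewrite ltNge -(@measure0 _ _ _ mu) => /negP; apply.
apply: (measure_le_level _ _ n) => //; first exact: measurable_ball.
by move=> y [/eL].
Qed.

Lemma cylinder_ball u n x (r : R) : cyl u n x -> len u n < r ->
  cylinder_mass u n <= ball_mass mu x r.
Proof.
move=> ux ur; rewrite -lee_fin -measure_cylinder -ball_massE.
apply: le_measure; rewrite ?inE; [exact: (cylinder_measurable hS)|exact: measurable_ball|].
move=> y uy; rewrite -ball_normE /ball_/= (le_lt_trans _ ur)//.
exact: (cylinder_diam hS).
Qed.

Lemma moran_support x : moran_set S w x -> measure_support mu x.
Proof.
move=> /(moran_address hS w)[u ux] r r0.
have r'0 : 0 < Num.min r 1 by rewrite lt_min r0 ltr01.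
have [|n [_ ltr _]] := exists_cylinder_length hS w u _ r'0.
  by rewrite ge_min lexx orbT.
rewrite ball_massE lte_fin (lt_le_trans (cylinder_mass_gt0 u n.+1))//.
by apply: cylinder_ball => //; rewrite (lt_le_trans ltr)// ge_min lexx.
Qed.

Lemma ball_mass_ge_cylinder u x (r : R) : (forall n, cyl u n x) ->
  0 < r -> r <= 1 -> exists n,
  [/\ A * r <= len u n, len u n < r
    & cylinder_mass u n <= ball_mass mu x r].
Proof.
move=> ux r0 r1; have [n [rle ltr Ale]] := exists_cylinder_length hS w u _ r0 r1.
exists n.+1; split=> //; last exact: cylinder_ball.
by rewrite (le_trans _ Ale)// ler_wpM2l// ltW.
Qed.

(** When [r <= tau * len u n], separation prevents [ball x r] from meeting any
    cylinder of level [n] other than that of [x]. *)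
Lemma ball_mass_le_cylinder u x (r : R) : (forall n, cyl u n x) ->
  0 < r -> r <= tau -> exists n,
  [/\ r <= tau * len u n, A * tau * len u n <= r
    & ball_mass mu x r <= cylinder_mass u n].
Proof.
move=> ux r0 r1; have rt0 : 0 < r / tau by exact: divr_gt0.
have [|n [rle ltr Ale]] := exists_cylinder_length hS w u _ rt0.
  by rewrite ler_pdivrMr// mul1r.
have rtau : r <= tau * len u n by rewrite mulrC -ler_pdivrMr.
exists n; split=> //.
  by rewrite mulrAC -ler_pdivlMr// (le_trans Ale)// ltW.
rewrite -lee_fin -measure_cylinder -ball_massE.
apply: (measure_le_level _ _ n).
- exact: measurable_ball.
- exact: (cylinder_measurable hS).
move=> y [xy [s _]]; rewrite (moran_interval_cylinder _ _ _ j0) => sy.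
have e := eq_prefix hS w _ _ n _ _ (ux n) sy.
rewrite /cylinder (eq_branch w _ (nth j0 s))// => k kn.
by apply: e => //; move: xy; rewrite -ball_normE /ball_/= => /lt_le_trans; exact.
Qed.

Lemma cylinder_mass_ge_length u (s : R) n m :
    (forall k j, a (w k) j `^ s <= p (w k) j) -> (n <= m)%N ->
  len u m `^ s * cylinder_mass u n <= cylinder_mass u m * len u n `^ s.
Proof.
move=> ap /subnK <-; elim: (m - n)%N => [|k IH]; first by rewrite mulrC.
rewrite addSn cylinder_lengthS cylinder_massS.
rewrite powRM ?(ltW (cylinder_length_gt0 hS _ _ _)) ?(ltW (factor_gt0 hS _ _))//.
rewrite mulrAC [leRHS]mulrAC ler_pM ?powR_ge0//.
by rewrite mulr_ge0 ?powR_ge0 ?(ltW (cylinder_mass_gt0 _ _)).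
Qed.

Lemma cylinder_mass_le_length u (s : R) n m :
    (forall k j, p (w k) j <= a (w k) j `^ s) -> (n <= m)%N ->
  cylinder_mass u m * len u n `^ s <= len u m `^ s * cylinder_mass u n.
Proof.
move=> pa /subnK <-; elim: (m - n)%N => [|k IH]; first by rewrite mulrC.
rewrite addSn cylinder_lengthS cylinder_massS.
rewrite powRM ?(ltW (cylinder_length_gt0 hS _ _ _)) ?(ltW (factor_gt0 hS _ _))//.
rewrite mulrAC [leRHS]mulrAC ler_pM ?(ltW (p_gt0 _ _))//.
by rewrite mulr_ge0 ?powR_ge0 ?(ltW (cylinder_mass_gt0 _ _)).
Qed.

(* The product of the two losses made when a ball is replaced by a cylinder. *)
Let q : R := (A * tau * A)^-1.
Let q0 : 0 < q. Proof. by rewrite invr_gt0 !mulr_gt0. Qed.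

Let scale_ratio (x y r rr : R) : 0 < y -> 0 < r ->
  A * tau * x <= rr -> A * r <= y -> 0 < x -> x / y <= q * (rr / r).
Proof.
move=> y0 r0 xrr ry x0; rewrite ler_pdivrMr// /q.
have -> : (A * tau * A)^-1 * (rr / r) * y = rr * y / (A * tau * (A * r)).
  by field; rewrite !gt_eqF.
rewrite ler_pdivlMr ?mulr_gt0//.
have -> : x * (A * tau * (A * r)) = (A * tau * x) * (A * r) by ring.
rewrite ler_pM//.
- by rewrite !mulr_ge0// ltW.
- by rewrite !mulr_ge0// ltW.
Qed.

(** The cylinder inside the small ball is a descendant of the one around the large
    ball, and along the words between them masses shrink at most as fast as the
    [s]-th power of lengths. *)
Lemma moran_mass_growth_le (s : R) : 0 <= s ->
    (forall k j, a (w k) j `^ s <= p (w k) j) ->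
  mass_growth_le mu (moran_set S w) s.
Proof.
move=> s0 ap; exists (q `^ s), tau; split=> //; first exact: powR_gt0.
move=> x rr r /(moran_address hS w)[u ux] r0 rle rrtau.
have rr0 : 0 < rr by exact: lt_le_trans rle.
have tau1 := tau_le1 hS.
have [n [nlo nhi mrr]] := ball_mass_le_cylinder _ _ _ ux rr0 rrtau.
have [m [mlo mhi mr]] := ball_mass_ge_cylinder _ _ _ ux r0 ltac:(lra).
have Ln := cylinder_length_gt0 hS w u n; have Lm := cylinder_length_gt0 hS w u m.
have nm : (n <= m)%N.
  rewrite leqNgt; apply/negP => /ltnW/(cylinder_length_anti hS w u) Lle.
  have : tau * len u n <= len u n by rewrite ler_piMl// ltW.
  lra.
apply: (le_trans mrr).
apply: (@le_trans _ _ ((len u n / len u m) `^ s * cylinder_mass u m)).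
  rewrite powR_div// mulrAC ler_pdivlMr ?powR_gt0// mulrC [leRHS]mulrC.
  exact: cylinder_mass_ge_length.
rewrite ler_pM ?powR_ge0 ?(ltW (cylinder_mass_gt0 _ _))//.
rewrite -powRM ?(ltW q0) ?divr_ge0 ?(ltW rr0) ?(ltW r0)//.
apply: powR_le_base => //; first by rewrite divr_ge0// ltW.
exact: scale_ratio.
Qed.

(** Dual comparison, with a cylinder inside the large ball and one around the small
    ball.  These may be nested in the wrong order, but then the two radii are
    comparable and monotonicity of the mass suffices. *)
Lemma moran_mass_growth_ge (s : R) : 0 <= s ->
    (forall k j, p (w k) j <= a (w k) j `^ s) ->
  mass_growth_ge mu (moran_set S w) s.
Proof.
move=> s0 pa; exists (q `^ s), tau; split=> //; first exact: powR_gt0.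
move=> x rr r /(moran_address hS w)[u ux] r0 rle rrtau.
have rr0 : 0 < rr by exact: lt_le_trans rle.
have tau1 := tau_le1 hS.
have [n [nlo nhi mrr]] := ball_mass_ge_cylinder _ _ _ ux rr0 ltac:(lra).
have [m [mlo mhi mr]] := ball_mass_le_cylinder _ _ _ ux r0 (le_trans rle rrtau).
have Ln := cylinder_length_gt0 hS w u n; have Lm := cylinder_length_gt0 hS w u m.
have rat0 : 0 <= rr / r by rewrite divr_ge0// ltW.
have rat : rr / r * (len u m / len u n) <= q.
  have -> : q = rr / r * (q * (r / rr)) by field; rewrite !gt_eqF.
  by rewrite ler_wpM2l//; exact: scale_ratio.
have [nm|/ltnW/(cylinder_length_anti hS w u) Lle] := leqP n m.
  have mle : ball_mass mu x r <= (len u m / len u n) `^ s * ball_mass mu x rr.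
    apply: (le_trans mr).
    apply: (@le_trans _ _ ((len u m / len u n) `^ s * cylinder_mass u n)).
      rewrite powR_div// mulrAC ler_pdivlMr ?powR_gt0//.
      exact: cylinder_mass_le_length.
    by rewrite ler_wpM2l ?powR_ge0.
  apply: le_trans (ler_wpM2l (powR_ge0 _ _) mle) _.
  rewrite mulrA ler_wpM2r ?ball_mass_ge0// -powRM ?rat0 ?divr_ge0 ?(ltW Ln) ?(ltW Lm)//.
  apply: powR_le_base => //; first by rewrite mulr_ge0// divr_ge0// ltW.
rewrite ler_pM ?powR_ge0 ?ball_mass_ge0//.
  apply: powR_le_base => //; apply: le_trans rat.
  by rewrite ler_peMr// ler_pdivlMr ?mul1r.
by apply/le_ball_mass/ball_subset_ball; rewrite subrr normr0 add0r.
Qed.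

Lemma moran_mass_power_law u x (s : R) : 0 <= s ->
    (forall n, cyl u n x) ->
    (forall k, p (w k) (u k) = a (w k) (u k) `^ s) ->
  mass_power_law mu x s.
Proof.
move=> s0 ux pa.
have massE n : cylinder_mass u n = len u n `^ s.
  elim: n => [|n IH].
    by rewrite /cylinder_mass cylinder_length0 big_ord0 powR1.
  rewrite cylinder_lengthS cylinder_massS IH pa.
  by rewrite powRM ?(ltW (cylinder_length_gt0 hS _ _ _)) ?(ltW (factor_gt0 hS _ _)).
have At : 0 < A * tau by rewrite mulr_gt0.
exists (A `^ s), ((A * tau)^-1 `^ s), tau; split=> //.
- exact: powR_gt0.
- by rewrite powR_gt0// invr_gt0.
move=> r r0 rtau; have tau1 := tau_le1 hS.
rewrite -!powRM ?(ltW A0) ?(ltW r0) ?invr_ge0 ?(ltW At)//.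
apply/andP; split.
  have [n [nlo _]] := ball_mass_ge_cylinder _ _ _ ux r0 ltac:(lra).
  apply: le_trans; rewrite massE; apply: powR_le_base => //.
  by rewrite mulr_ge0// ltW.
have [n [_ nhi mn]] := ball_mass_le_cylinder _ _ _ ux r0 rtau.
apply: (le_trans mn); rewrite massE; apply: powR_le_base => //.
  exact/ltW/(cylinder_length_gt0 hS).
by rewrite ler_pdivlMl.
Qed.

End MoranMeasures.

(** * Dimensions of Moran measures and Moran sets *)

Lemma exists_powR_le {R : realType} (b c : R) : 0 < b < 1 -> 0 < c ->
  exists2 t : R, 0 <= t & b `^ t <= c.
Proof.
move=> /andP[b0 b1] c0.
have lb : ln b < 0 by rewrite ln_lt0// b0.
exists (`|ln c| / - ln b); first by rewrite divr_ge0// oppr_ge0 ltW.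
rewrite -ler_ln ?posrE ?powR_gt0// ln_powR invrN mulrN mulNr mulfVK ?lt_eqF//.
by have := ler_norm (- ln c); rewrite normrN; lra.
Qed.

Section MoranDimensions.
Context {R : realType} {disp : measure_display} {Omega0 : measurableType disp}.
Context {K : nat} {A B tau : R}.
Context {S : Omega0 -> 'I_K -> R -> R} {a p : Omega0 -> 'I_K -> R}.
Hypothesis hS : random_ifs A B tau S a.
Hypothesis p_gt0 : forall w j, 0 < p w j.
Hypothesis p_sum : forall w, \sum_j p w j = 1.
Variables (w : nat -> Omega0) (mu : probability (measurableTypeR R) R).
Hypothesis hmu : moran_measure S p w mu.
Variables (Phi : R -> R) (r : R) (u : nat -> 'I_K).
Hypothesis Phi0 : forall t, 0 < t < 1 -> 0 <= Phi t.
Hypothesis r0 : 0 < r.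
Hypothesis pinned : forall k, p (w k) (u k) = a (w k) (u k) `^ r.

Let support_sub x : measure_support mu x -> moran_set S w x :=
  support_moran hS p_sum w mu hmu x.

Let moran_sub x : moran_set S w x -> measure_support mu x :=
  moran_support hS p_gt0 w mu hmu x.

Let pinned_point : exists2 x, measure_support mu x & mass_power_law mu x r.
Proof.
have [x ux] := cylinders_meet hS w u.
exists x; first exact/moran_sub/address_moran.
exact: (moran_mass_power_law hS p_sum w mu hmu u x r (ltW r0) ux pinned).
Qed.

Lemma moran_upper_dimensions :
  (forall k j, a (w k) j `^ r <= p (w k) j) ->
  upper_dim_measure Phi mu = r%:E /\ (upper_dim_set Phi (moran_set S w) <= r%:E)%E.
Proof.
move=> ap.
have [C [rho [C0 rho0 H]]] :=
  moran_mass_growth_le hS p_gt0 p_sum w mu hmu r (ltW r0) ap.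
split.
  apply/eqP; rewrite eq_le; apply/andP; split.
    apply: upper_dim_measure_le; exists C, rho; split=> // x rr t sx.
    by apply: H; exact: support_sub.
  have [x sx xlaw] := pinned_point.
  exact: upper_dim_measure_ge Phi0 x r sx xlaw.
apply: upper_dim_set_le moran_sub _; last by exists C, rho.
move=> x /(_ 0%N I)[s _]; rewrite (moran_interval_cylinder _ _ _ (u 0)).
exact: (cylinder_unit hS).
Qed.

(** Weights at least [c] dominate [a ^ t] as soon as [B ^ t <= c]; this gives the
    doubling property on which the bound for the covering numbers rests. *)
Lemma moran_lower_dimensions (c : R) : 0 < c -> (forall k j, c <= p (w k) j) ->
  (forall k j, p (w k) j <= a (w k) j `^ r) ->
  lower_dim_measure Phi mu = r%:E /\ (r%:E <= lower_dim_set Phi (moran_set S w))%E.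
Proof.
move=> c0 cp pa.
have [C [rho [C0 rho0 H]]] :=
  moran_mass_growth_ge hS p_gt0 p_sum w mu hmu r (ltW r0) pa.
split.
  apply/eqP; rewrite eq_le; apply/andP; split; last first.
    apply: lower_dim_measure_ge; exists C, rho; split=> // x rr t sx.
    by apply: H; exact: support_sub.
  have [x sx xlaw] := pinned_point.
  exact: lower_dim_measure_le Phi0 x r sx xlaw.
have [|t t0 Bt] := exists_powR_le B c _ c0; first by rewrite (rifs_B hS) (rifs_B1 hS).
apply: (lower_dim_set_ge mu Phi _ r t _ moran_sub).
- exact: (moran_set_compl_negligible hS p_sum w mu hmu).
- by exists C, rho.
apply: (moran_mass_growth_le hS p_gt0 p_sum w mu hmu) => // k j.
apply: le_trans (cp k j); apply: le_trans Bt.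
by apply: powR_le_base => //; [exact/ltW/(factor_gt0 hS)|exact: (factor_le hS)].
Qed.

End MoranDimensions.

(** * The weights *)

Section PinnedWeights.
Context {R : realType} {K : nat}.
Variables (i0 : 'I_K) (r : R).
Implicit Types (v : 'I_K -> R) (j : 'I_K).

Definition pinned_weights v j : R :=
  if j == i0 then v i0 `^ r
  else (1 - v i0 `^ r) * v j `^ r / \sum_(i | i != i0) v i `^ r.

Hypothesis K2 : (2 <= K)%N.
Hypothesis r0 : 0 < r.

Lemma powR_factor_lt1 (x : R) : 0 < x < 1 -> 0 < x `^ r < 1.
Proof.
move=> /andP[x0 x1]; rewrite powR_gt0//=.
have <- : 1 `^ r = 1 by rewrite powR1.
by apply: gt0_ltr_powR; rewrite ?nnegrE ?(ltW x0).
Qed.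

Lemma other_factors_gt0 v : (forall j, 0 < v j < 1) ->
  0 < \sum_(i | i != i0) v i `^ r.
Proof.
move=> v01; have [i ii0] : exists i, i != i0.
  have /card_gt0P[i] : (0 < #|predC1 i0|)%N by rewrite cardC1 card_ord -subn1 subn_gt0.
  by rewrite inE => ii0; exists i.
rewrite (bigD1 i)//= ltr_pwDl//.
  by have /andP[vi0 _] := v01 i; exact: powR_gt0.
by apply: sumr_ge0 => k _; exact: powR_ge0.
Qed.

Lemma pinned_weights_sum v : (forall j, 0 < v j < 1) ->
  \sum_j pinned_weights v j = 1.
Proof.
move=> v01; rewrite (bigD1 i0)//= {1}/pinned_weights eqxx.
under eq_bigr => i ii0 do rewrite /pinned_weights (negbTE ii0).
rewrite -mulr_suml -mulr_sumr mulfK ?subrKC//.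
by rewrite gt_eqF// other_factors_gt0.
Qed.

Lemma pinned_weights_bound v (A B : R) : 0 < A -> B < 1 ->
    (forall j, A <= v j <= B) ->
  forall j, (1 - B `^ r) * A `^ r / K%:R <= pinned_weights v j.
Proof.
move=> A0 B1 vAB j.
have v01 i : 0 < v i < 1.
  by have /andP[Av vB] := vAB i; rewrite (lt_le_trans A0)//= (le_lt_trans vB).
have B0 : 0 < B.
  by have /andP[Av vB] := vAB i0; rewrite (lt_le_trans A0)// (le_trans Av).
have vr i : A `^ r <= v i `^ r <= B `^ r.
  have /andP[Av vB] := vAB i.
  by rewrite !powR_le_base ?(ltW r0) ?(ltW A0) ?(le_trans (ltW A0))//.
have /andP[Br0 Br1] : 0 < B `^ r < 1 by apply: powR_factor_lt1; rewrite B0.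
have Ar0 : 0 < A `^ r by exact: powR_gt0.
have K1 : 1 <= K%:R :> R by rewrite ler1n ltnW.
have K0 : 0 < K%:R :> R by lra.
have sumK : \sum_(i | i != i0) v i `^ r <= K%:R.
  rewrite -[K in K%:R]card_ord -sumr_const big_mkcond/=.
  apply: ler_sum => i _; case: ifP => // _.
  by have /andP[_] := vr i; lra.
have := other_factors_gt0 _ v01; rewrite /pinned_weights.
set s := \sum_(i | _) _ in sumK * => s0.
have [_|ji0] := eqVneq j i0.
  have /andP[Av _] := vr i0; apply: le_trans Av.
  rewrite ler_pdivrMr// mulrC ler_wpM2l ?(ltW Ar0)//; lra.
have /andP[Av _] := vr j; have /andP[_ vB] := vr i0.
rewrite ler_pM ?invr_ge0 ?(ltW K0)//.
- by rewrite mulr_ge0 ?(ltW Ar0)//; lra.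
- by rewrite ler_pM ?(ltW Ar0)//; lra.
- by rewrite lef_pV2 ?posrE.
Qed.

(** The common factor of [v j ^ r] for [j != i0] is [1 - v i0 ^ r] divided by the sum
    of the other powers; it is at least 1 exactly when all powers sum to at most 1. *)
Lemma powR_le_pinned_weights v : (forall j, 0 < v j < 1) ->
  \sum_j v j `^ r <= 1 -> forall j, v j `^ r <= pinned_weights v j.
Proof.
move=> v01 sum_le1 j; rewrite /pinned_weights; have s0 := other_factors_gt0 _ v01.
case: eqP => [->//|_]; rewrite ler_pdivlMr// mulrC ler_wpM2r ?powR_ge0//.
by move: sum_le1; rewrite (bigD1 i0)//=; lra.
Qed.

Lemma pinned_weights_le_powR v : (forall j, 0 < v j < 1) ->
  1 <= \sum_j v j `^ r -> forall j, pinned_weights v j <= v j `^ r.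
Proof.
move=> v01 sum_ge1 j; rewrite /pinned_weights; have s0 := other_factors_gt0 _ v01.
case: eqP => [->//|_]; rewrite ler_pdivrMr// [leRHS]mulrC ler_wpM2r ?powR_ge0//.
by move: sum_ge1; rewrite (bigD1 i0)//=; lra.
Qed.

End PinnedWeights.

Lemma pinned_weights_measurable {R : realType} {disp : measure_display}
    {Omega0 : measurableType disp} {K : nat} (i0 : 'I_K) (r : R)
    (a : Omega0 -> 'I_K -> R) (j : 'I_K) :
  (forall i, measurable_fun setT (fun w => a w i)) ->
  measurable_fun setT (fun w => pinned_weights i0 r (a w) j).
Proof.
move=> ma.
have mar i : measurable_fun setT (fun w => a w i `^ r).
  exact: (measurableT_comp (measurable_powR r) (ma i)).
rewrite /pinned_weights; case: eqP => [_|_]; first exact: mar.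
have -> : (fun w => (1 - a w i0 `^ r) * a w j `^ r / \sum_(i | i != i0) a w i `^ r) =
   (fun w => (1 - a w i0 `^ r) * a w j `^ r * (\sum_(i | i != i0) a w i `^ r) `^ (-1)).
  apply/funext => w; rewrite powR_inv1//.
  by apply: sumr_ge0 => i _; exact: powR_ge0.
apply: measurable_funM.
  apply: measurable_funM; last exact: mar.
  by apply: measurable_funB => //; exact: mar.
apply: (measurableT_comp (measurable_powR (-1))).
elim: (index_enum _) => [|i l IH].
  have -> : (fun w => \sum_(i <- [::] | i != i0) a w i `^ r) = cst 0.
    by apply/funext => w; rewrite big_nil.
  exact: measurable_cst.
have -> : (fun w => \sum_(i' <- i :: l | i' != i0) a w i' `^ r) =
    (fun w => (if i != i0 then a w i `^ r else 0) +
              \sum_(i' <- l | i' != i0) a w i' `^ r).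
  by apply/funext => w; rewrite big_cons; case: ifP => // _; rewrite add0r.
by apply: measurable_funD => //; case: (i != i0) => //; exact: mar.
Qed.

Lemma probability_weights_of_bound {R : realType} {disp : measure_display}
    {Omega0 : measurableType disp} (P : probability Omega0 R) {K : nat}
    (p : Omega0 -> 'I_K -> R) (c : R) : 0 < c ->
  (forall w i, c <= p w i) -> (forall w, \sum_i p w i = 1) ->
  (forall i, measurable_fun setT (fun w => p w i)) ->
  probability_weights P p.
Proof.
move=> c0 cp psum mp; split=> //; first by move=> w i; exact/ltW/(lt_le_trans c0).
exists 1 => // i.
have p0 w : 0 < p w i by exact: lt_le_trans (cp w i).
have e w : ((p w i `^ 1)%:E^-1)%E = (p w i `^ (-1))%:E.
  by rewrite powRr1 ?ltW// inver gt_eqF// powR_inv1// ltW.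
apply: (@le_lt_trans _ _ (\int[P]_w (cst c^-1%:E w))%E).
  apply: ge0_le_integral => //=.
  - by move=> w _; rewrite e lee_fin powR_ge0.
  - under eq_fun do rewrite e.
    by apply/measurable_EFinP; exact: (measurableT_comp (measurable_powR (-1))).
  - move=> w _; rewrite e lee_fin powR_inv1 ?(ltW (p0 w))//.
    by rewrite lef_pV2 ?posrE.
rewrite integral_cst// [X in (_ * X)%E](_ : _ = 1%E) ?mule1 ?ltry//.
exact: probability_setT.
Qed.

(** Each coordinate of the product has law [P], so it avoids a null set almost
    surely; there are countably many coordinates. *)
Lemma ae_forall_coordinates {R : realType} {disp : measure_display}
    {T : measurableType disp} (P : probability T R)
    (PP : probability (seq_space T) R) (Q : T -> Prop) :
  infinite_product_measure P PP -> {ae P, forall x, Q x} ->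
  {ae PP, forall w : seq_space T, forall k, Q (w k)}.
Proof.
move=> hPP [N [mN N0 QN]]; apply: ae_foralln => k.
pose D (i : 'I_k.+1) := if i == ord_max then N else setT.
have mD i : measurable (D i) by rewrite /D; case: ifP.
have DE : [set w : nat -> T | N (w k)] =
          [set w : nat -> T | forall i : 'I_k.+1, D i (w i)].
  rewrite predeqE => w; split=> [Nw i|/(_ ord_max)]; rewrite /D /=.
    by case: eqP => [->|].
  by rewrite eqxx.
exists [set w : nat -> T | N (w k)]; split.
- by apply: sub_gen_smallest; exists k, N.
- rewrite DE; apply: (etrans (hPP _ D mD)).
  by rewrite big_ord_recr/= {2}/D eqxx N0 mule0.
- by move=> w /= nQ; exact: QN.
Qed.

Lemma sum_powR_anti {R : realType} {K : nat} (v : 'I_K -> R) (s t : R) :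
  (forall j, 0 < v j < 1) -> s <= t -> \sum_j v j `^ t <= \sum_j v j `^ s.
Proof.
move=> v01 st; apply: ler_sum => j _; have /andP[v0 v1] := v01 j.
by apply: ger_powR; rewrite ?v0 ?(ltW v1).
Qed.

(** * Attainable dimensions *)

Theorem theorem4 (R : realType) (disp : measure_display)
    (Omega0 : measurableType disp) (P : probability Omega0 R)
    (PP : probability (seq_space Omega0) R)
    (K : nat) (A B tau : R)
    (S : Omega0 -> 'I_K -> R -> R) (a : Omega0 -> 'I_K -> R)
    (dw : Omega0 -> R)
    (hPP : infinite_product_measure P PP)
    (hS : random_ifs A B tau S a)
    (hd : forall w, 0 <= dw w /\ \sum_j a w j `^ dw w = 1) :
  (forall r : R, (ess_sup P (fun w => (dw w)%:E) <= r%:E)%E ->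
    exists p : Omega0 -> 'I_K -> R,
      [/\ probability_weights P p, depends_on a p, bounded_away_from_zero p &
        {ae PP, forall w, forall mu : probability (measurableTypeR R) R,
          moran_measure S p w mu ->
          forall Phi : R -> R, small_dimension_function Phi ->
            upper_dim_measure Phi mu = r%:E /\
            (upper_dim_set Phi (moran_set S w) <= r%:E)%E}])
  /\
  (forall r : R, 0 < r -> (r%:E <= ess_inf P (fun w => (dw w)%:E))%E ->
    exists p : Omega0 -> 'I_K -> R,
      [/\ probability_weights P p, depends_on a p, bounded_away_from_zero p &
        {ae PP, forall w, forall mu : probability (measurableTypeR R) R,
          moran_measure S p w mu ->
          forall Phi : R -> R, small_dimension_function Phi ->
            lower_dim_measure Phi mu = r%:E /\
            (r%:E <= lower_dim_set Phi (moran_set S w))%E}]).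
Proof.
have K2 := rifs_K hS; have B0 := rifs_B hS; have B1 := rifs_B1 hS.
have A0 := rifs_A hS.
pose i0 : 'I_K := Ordinal (ltnW K2).
have a01 w j : 0 < a w j < 1 by rewrite (factor_gt0 hS) (factor_lt1 hS).
pose p r w := pinned_weights i0 r (a w).
have p_sum r w : \sum_j p r w j = 1 by exact: pinned_weights_sum.
pose c r := (1 - B `^ r) * A `^ r / K%:R.
have c_gt0 r : 0 < r -> 0 < c r.
  move=> r0; rewrite divr_gt0 ?ltr0n ?(ltnW K2)// mulr_gt0 ?powR_gt0// subr_gt0.
  by have /andP[] : 0 < B `^ r < 1 by apply: powR_factor_lt1; rewrite ?B0.
have cp r : 0 < r -> forall w j, c r <= p r w j.
  move=> r0 w j; apply: pinned_weights_bound => // i.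
  by rewrite (factor_ge hS) (factor_le hS).
have weights r : 0 < r -> [/\ probability_weights P (p r), depends_on a (p r)
                          & bounded_away_from_zero (p r)].
  move=> r0; split; last by exists (c r); [exact: c_gt0|exact: cp].
    apply: (probability_weights_of_bound P (p r) (c r)) => //.
    - exact: c_gt0.
    - exact: cp.
    - move=> j; apply: pinned_weights_measurable; exact: (rifs_random hS).
  by exists (pinned_weights i0 r).
have pinned r w : p r w i0 = a w i0 `^ r by rewrite /p /pinned_weights eqxx.
have Phi_ge0 (Phi : R -> R) : small_dimension_function Phi ->
  forall t, 0 < t < 1 -> 0 <= Phi t by move=> [[]].
split=> r.
- move=> /ess_supP dwr.
  (* At exponent 0 the sum is [K >= 2], so every similarity dimension is positive
     and, [P] having mass 1, so is [r]. *)
  have dw_gt0 w : 0 < dw w.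
    have [dw0 sum1] := hd w; rewrite lt_neqAle dw0 andbT; apply/eqP => dwE.
    move: sum1; rewrite -dwE; under eq_bigr do rewrite powRr0.
    rewrite sumr_const card_ord => /eqP; rewrite -[eqbRHS]mulr1n eqr_nat.
    by move/eqP => K1; have := rifs_K hS; rewrite {1}K1.
  have r0 : 0 < r.
    apply: contrapT => r0; have [N [mN N0 NN]] := dwr.
    have : P setT = 0%E.
      apply/eqP; rewrite -measure_le0 -N0; apply: le_measure; rewrite ?inE//.
      apply: subset_trans NN => w _ /=; rewrite lee_fin => dwr'; apply: r0.
      exact: lt_le_trans (dw_gt0 w) dwr'.
    by rewrite probability_setT => /eqP; rewrite onee_eq0.
  have [wp dp bp] := weights r r0; exists (p r); split=> //.
  apply: filterS (ae_forall_coordinates P PP _ hPP dwr) => w dww mu hmu Phi /Phi_ge0 P0.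
  apply: (moran_upper_dimensions hS _ (p_sum r) w mu hmu Phi r (fun=> i0) P0 r0) => //.
    by move=> w' j; exact: lt_le_trans (c_gt0 r r0) (cp r r0 w' j).
  move=> k j; apply: powR_le_pinned_weights => //.
  have [_ <-] := hd (w k); apply: sum_powR_anti => //.
  by have := dww k; rewrite lee_fin.
- move=> r0 /ess_infP dwr.
  have [wp dp bp] := weights r r0; exists (p r); split=> //.
  apply: filterS (ae_forall_coordinates P PP _ hPP dwr) => w dww mu hmu Phi /Phi_ge0 P0.
  apply: (moran_lower_dimensions hS _ (p_sum r) w mu hmu Phi r (fun=> i0) P0 r0 _ (c r)).
  + by move=> w' j; exact: lt_le_trans (c_gt0 r r0) (cp r r0 w' j).
  + by move=> k.
  + exact: c_gt0.
  + by move=> k j; exact: cp.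
  move=> k j; apply: pinned_weights_le_powR => //.
  have [_ <-] := hd (w k); apply: sum_powR_anti => //.
  by have := dww k; rewrite lee_fin.
Qed.
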